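(* Assume $0 < \underline{\gamma} < \overline{\gamma}$ and $\underline{\beta} < 0 < \overline{\beta}$. Then $\operatorname{conv}(T) = R^3$.
   Context: Let $\underline{\gamma}, \overline{\gamma}, \underline{\beta}, \overline{\beta}$ be real parameters; $\operatorname{conv}$ denotes the convex hull. The set $T \subseteq \mathbb{R}^5$ consists of all $(x,u,y,z,t)$ satisfying $$u = x t,\quad y + u \le 0,\quad z + x \le 1,\quad y \le \overline{\beta} z,\quad y \ge \underline{\beta} z,\quad z \ge 0,\quad x \in [0,1],\quad t \in [\underline{\gamma}, \overline{\gamma}].$$ The set $R^0 \subseteq \mathbb{R}^5$ consists of all $(x,u,y,z,t)$ satisfying $$y + u \le 0,\quad z + x \le 1,\quad y \le \overline{\beta} z,\quad y \ge \underline{\beta} z,$$ $$u - \underline{\gamma} x \ge 0,\quad \overline{\gamma} x - u \ge 0,\quad u - \underline{\gamma} x \le t - \underline{\gamma},\quad \overline{\gamma} x - u \le \overline{\gamma} - t.$$ The set $R^3$ consists of all $(x,u,y,z,t) \in R^0$ satisfying both $$(u - \underline{\beta} x)(u - \underline{\gamma} x) \leq - \underline{\beta}\, x (t - \underline{\gamma})$$ and $$(\underline{\gamma} - \underline{\beta})(\overline{\gamma} x - u) \leq -\underline{\beta} (\overline{\gamma} - t).$$ *)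

(* Defs.v *)
From HB Require Import structures.
From mathcomp Require Import all_boot all_order all_algebra.
From mathcomp Require Import boolp classical_sets reals convex.

Set Implicit Arguments.
Unset Strict Implicit.
Unset Printing Implicit Defensive.

Import Order.TTheory GRing.Theory Num.Theory.

Local Open Scope classical_set_scope.
Local Open Scope ring_scope.

Definition convex_hull (K : numDomainType) (E : lmodType K) (A : set E)
    : set E :=
  smallest (@convex_set K E) A.

(* A point (x, u, y, z, t) of R^5 is a row vector p, with 0-based coordinates;
   the column indices below are numerals of 'I_5.
   gl, gu, bl, bu are the lower and upper gammas and betas. *)
Definition set_T (R : realType) (gl gu bl bu : R) : set 'rV[R]_5 :=
  [set p : 'rV[R]_5 | let x := p 0 0 in let u := p 0 1 in let y := p 0 2 in
           let z := p 0 3 in let t := p 0 4 in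
    u = x * t /\ y + u <= 0 /\ z + x <= 1 /\ y <= bu * z /\ y >= bl * z /\
    z >= 0 /\ 0 <= x <= 1 /\ gl <= t <= gu].

Definition set_R0 (R : realType) (gl gu bl bu : R) : set 'rV[R]_5 :=
  [set p : 'rV[R]_5 | let x := p 0 0 in let u := p 0 1 in let y := p 0 2 in
           let z := p 0 3 in let t := p 0 4 in
    y + u <= 0 /\ z + x <= 1 /\ y <= bu * z /\ y >= bl * z /\
    u - gl * x >= 0 /\ gu * x - u >= 0 /\
    u - gl * x <= t - gl /\ gu * x - u <= gu - t].

Definition set_R3 (R : realType) (gl gu bl bu : R) : set 'rV[R]_5 :=
  [set p : 'rV[R]_5 | let x := p 0 0 in let u := p 0 1 in let t := p 0 4 in
    set_R0 gl gu bl bu p /\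
    (u - bl * x) * (u - gl * x) <= - bl * x * (t - gl) /\
    (gl - bl) * (gu * x - u) <= - bl * (gu - t)].

(* Main.v *)
Require Import Defs.
From mathcomp Require Import all_boot all_order all_algebra.
From mathcomp Require Import boolp classical_sets reals convex.
From mathcomp Require Import interval_inference ring lra.

(** Write b = - bl > 0. For fixed (x, u, t), the conditions on (y, z) that
    matter are y + u <= 0, z + x <= 1 and - b z <= y; they cut out a triangle
    of fixed shape whose size is b (1 - x) - u, an affine function of the
    point. The triangle is nonempty exactly when u <= b (1 - x), and where this
    is an equality it shrinks to a single point, [tight_point]. On T, where u =
    x t, the equality says x = b / (t + b): a curve with one point for each
    value of t between gl and gu.

    Every point of T satisfies x (t + b) <= b, hence also x (gl + b) <= b.
    Multiplying these by the nonnegative factors x (t - gl) and gu - t yields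
    the two additional inequalities of R3 ([set_T_sub_R3]). The quadratic one
    reads u^2 <= x w with x and w nonnegative and affine, so it is a
    second-order cone constraint and R3 is convex ([set_R3_convex]). Hence conv
    T lies in R3.

    Conversely, in the space of (x, u, t) a point of R3 with x > 0 is cut by
    the line of direction t; put r = u / x and lam = x + u / b <= 1. The point
    is a convex combination, with weights lam and 1 - lam, of a point of the
    plane u = b (1 - x), necessarily with x-coordinate b / (r + b), and of a
    point of the segment x = u = 0, gl <= t <= gu, over which T consists of the
    whole triangle ([apex_in_T]). The plane contains the curve above, and the
    part of its convex hull over b / (r + b) is the segment from t = r on the
    curve up to the chord joining the two ends of the curve
    ([tight_point_in_hull]). The t-coordinates reached in this way therefore
    form an interval. Its lower end is lam r + (1 - lam) gl, and lying above it
    is the quadratic inequality of R3 divided by b x; lying below its upper end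
    is the last linear inequality of R3 divided by b. The coordinates (y, z)
    follow because the triangle over the tight point has size zero, so the
    triangle over x = u = 0 accounts for all the slack ([triangle_rescale]). *)

Set Implicit Arguments.
Unset Strict Implicit.
Unset Printing Implicit Defensive.

Import Order.TTheory GRing.Theory Num.Theory.

Local Open Scope classical_set_scope.
Local Open Scope ring_scope.

(** * Convex combinations of points given by five coordinates *)

Lemma convex_setP (R : numDomainType) (M : lmodType R) (A : set M) :
  convex_set (M := M) A <->
  (forall (p q : M) (l : R), A p -> A q -> 0 <= l <= 1 ->
     A (l *: p + (1 - l) *: q)).
Proof.
split=> [cA p q l Ap Aq l01|cA p q l /set_mem Ap /set_mem Aq].
  have := cA p q (@Itv01 R l (andP l01).1 (andP l01).2).
  by move=> /(_ (mem_set Ap) (mem_set Aq)) /set_mem.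
by apply: mem_set; apply: cA => //; apply/andP; split.
Qed.

Definition vec5 (R : nmodType) (x u y z t : R) : 'rV[R]_5 :=
  \row_j [:: x; u; y; z; t]`_j.

Lemma vec5_eta (R : nmodType) (p : 'rV[R]_5) :
  p = vec5 (p 0 0) (p 0 1) (p 0 2) (p 0 3) (p 0 4).
Proof.
apply/rowP => j; rewrite mxE.
by case: j => [[|[|[|[|[|j]]]]] // hj] /=; congr (p _ _); apply: val_inj.
Qed.

Lemma convex_vec5 (R : numDomainType) (A : set 'rV[R]_5)
    (l x u y z t x1 u1 y1 z1 t1 x2 u2 y2 z2 t2 : R) :
  convex_set (M := 'rV[R]_5) A ->
  A (vec5 x1 u1 y1 z1 t1) -> A (vec5 x2 u2 y2 z2 t2) -> 0 <= l <= 1 ->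
  x = l * x1 + (1 - l) * x2 -> u = l * u1 + (1 - l) * u2 ->
  y = l * y1 + (1 - l) * y2 -> z = l * z1 + (1 - l) * z2 ->
  t = l * t1 + (1 - l) * t2 ->
  A (vec5 x u y z t).
Proof.
move=> cA A1 A2 l01 -> -> -> -> ->.
suff -> : vec5 (l * x1 + (1 - l) * x2) (l * u1 + (1 - l) * u2)
    (l * y1 + (1 - l) * y2) (l * z1 + (1 - l) * z2) (l * t1 + (1 - l) * t2) =
    l *: vec5 x1 u1 y1 z1 t1 + (1 - l) *: vec5 x2 u2 y2 z2 t2.
  by move/convex_setP : cA => cA; apply: cA.
by apply/rowP => j; rewrite !mxE; case: j => [[|[|[|[|[|j]]]]] // hj].
Qed.

Lemma itv_interpolation (R : realFieldType) (a b c : R) :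
  a <= c -> c <= b -> exists2 l, 0 <= l <= 1 & c = l * a + (1 - l) * b.
Proof.
move=> ac cb; have [ab|ab] := leP b a.
  by exists 0; [rewrite lexx ler01|lra].
exists ((b - c) / (b - a)); last by field; lra.
by rewrite divr_ge0 ?ler_pdivrMr; lra.
Qed.

Lemma set_T_vec5 (R : realType) (gl gu bl bu x u y z t : R) :
  set_T gl gu bl bu (vec5 x u y z t) <->
  [/\ [/\ u = x * t, y + u <= 0 & z + x <= 1],
      [/\ y <= bu * z, bl * z <= y & 0 <= z], 0 <= x <= 1 & gl <= t <= gu].
Proof.
rewrite /set_T /= !mxE /=; split; first by move=> [? [? [? [? [? [? [? ?]]]]]]].
by move=> [[? ? ?] [? ? ?] ? ?].
Qed.

Lemma set_R3_vec5 (R : realType) (gl gu bl bu x u y z t : R) :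
  set_R3 gl gu bl bu (vec5 x u y z t) <->
  [/\ [/\ y + u <= 0, z + x <= 1, y <= bu * z & bl * z <= y],
      [/\ 0 <= u - gl * x, 0 <= gu * x - u,
          u - gl * x <= t - gl & gu * x - u <= gu - t],
      (u - bl * x) * (u - gl * x) <= - bl * x * (t - gl) &
      (gl - bl) * (gu * x - u) <= - bl * (gu - t)].
Proof.
rewrite /set_R3 /set_R0 /= !mxE /=; split.
  by move=> [[? [? [? [? [? [? [? ?]]]]]]] [? ?]].
by move=> [[? ? ? ?] [? ? ? ?] ? ?].
Qed.

(** * T is contained in R3 *)

(** On T the chain x t <= - y <= - bl z <= - bl (1 - x) bounds x (t - bl) by
    - bl, hence also x (gl - bl). Each of the two additional inequalities of R3
    is one of these bounds times a nonnegative factor. *)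
Lemma set_T_sub_R3 (R : realType) (gl gu bl bu : R)
    (hgl : 0 < gl) (hbl : bl < 0) :
  set_T gl gu bl bu `<=` set_R3 gl gu bl bu.
Proof.
move=> p; rewrite (vec5_eta p) => /set_T_vec5.
move: (p 0 0) (p 0 1) (p 0 2) (p 0 3) (p 0 4) => x u y z t.
move=> [[-> yu zx] [ybu ybl z0] /andP[x0 x1] /andP[glt tgu]].
have tight : x * (t - bl) <= - bl by nra.
apply/set_R3_vec5; split.
- by split.
- split; nra.
- rewrite -subr_ge0.
  have -> : - bl * x * (t - gl) - (x * t - bl * x) * (x * t - gl * x) =
    x * (t - gl) * (- bl - x * (t - bl)) by ring.
  by rewrite !mulr_ge0 ?subr_ge0.
- have glx : x * (gl - bl) <= - bl by nra.
  rewrite -subr_ge0.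
  have -> : - bl * (gu - t) - (gl - bl) * (gu * x - x * t) =
    (gu - t) * (- bl - x * (gl - bl)) by ring.
  by rewrite mulr_ge0 ?subr_ge0.
Qed.

(** * Convexity of R3 *)

(** The cone v^2 <= x w in the quadrant x, w >= 0: expanding both sides leaves
    the cross term 2 v1 v2 <= x1 w2 + x2 w1, which is the inequality between
    the geometric and arithmetic means of x1 w2 and x2 w1. *)
Lemma rotated_cone_convex (R : realFieldType) (l x1 w1 v1 x2 w2 v2 : R) :
  0 <= l <= 1 -> 0 <= x1 -> 0 <= w1 -> v1 ^+ 2 <= x1 * w1 ->
  0 <= x2 -> 0 <= w2 -> v2 ^+ 2 <= x2 * w2 ->
  (l * v1 + (1 - l) * v2) ^+ 2 <=
  (l * x1 + (1 - l) * x2) * (l * w1 + (1 - l) * w2).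
Proof.
move=> /andP[l0 l1] x10 w10 h1 x20 w20 h2.
have cross : (v1 * v2) *+ 2 <= x1 * w2 + x2 * w1.
  apply: le_trans (ler_norm _) _.
  rewrite -ler_sqr ?nnegrE ?addr_ge0 ?mulr_ge0 // real_normK ?num_real //.
  have : v1 ^+ 2 * v2 ^+ 2 <= (x1 * w1) * (x2 * w2).
    by apply: ler_pM => //; apply: sqr_ge0.
  have := sqr_ge0 (x1 * w2 - x2 * w1).
  rewrite !expr2; lra.
have h1' : 0 <= l ^+ 2 * (x1 * w1 - v1 ^+ 2).
  by rewrite mulr_ge0 ?sqr_ge0 ?subr_ge0.
have h2' : 0 <= (1 - l) ^+ 2 * (x2 * w2 - v2 ^+ 2).
  by rewrite mulr_ge0 ?sqr_ge0 ?subr_ge0.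
have h3' : 0 <= (l * (1 - l)) * (x1 * w2 + x2 * w1 - v1 * v2 *+ 2).
  by rewrite !mulr_ge0 ?subr_ge0.
lra.
Qed.

(** Moving every multiple of x to the right turns the quadratic inequality into
    u^2 <= x w with w affine. The signs of x and w, which convexity of the cone
    requires, follow from the other inequalities: gl x <= u <= gu x gives
    0 <= x, and then w >= u^2 / x when x > 0, while for x = 0 also u = 0 and
    w = - bl (t - gl). *)
Lemma set_R3_cone (R : realType) (gl gu bl bu x u y z t : R) :
  gl < gu -> bl < 0 ->
  set_R3 gl gu bl bu (vec5 x u y z t) <->
  [/\ [/\ y + u <= 0, z + x <= 1, y <= bu * z & bl * z <= y],
      [/\ 0 <= u - gl * x, 0 <= gu * x - u,
          u - gl * x <= t - gl & gu * x - u <= gu - t],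
      [/\ 0 <= x, 0 <= - bl * (t - gl) + (gl + bl) * u - bl * gl * x &
          u ^+ 2 <= x * (- bl * (t - gl) + (gl + bl) * u - bl * gl * x)] &
      (gl - bl) * (gu * x - u) <= - bl * (gu - t)].
Proof.
move=> hg hbl; split=> [/set_R3_vec5[h1 h2 h3 h4]|]; last first.
  move=> [h1 h2 [x0 w0 h3] h4].
  by apply/set_R3_vec5; split=> //; lra.
split=> //; case: h2 => glx gux mc1 mc2.
have x0 : 0 <= x by rewrite -(pmulr_rge0 x (_ : 0 < gu - gl)) ?subr_gt0 //; lra.
have soc : u ^+ 2 <= x * (- bl * (t - gl) + (gl + bl) * u - bl * gl * x) by lra.
split=> //; have [x_gt0|x_le0] := ltP 0 x.
  by rewrite -(pmulr_rge0 _ x_gt0) (le_trans _ soc) ?sqr_ge0.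
have x00 : x = 0 by lra.
subst x; have -> : u = 0 by lra.
rewrite !mulr0 addr0 subr0 mulr_ge0; lra.
Qed.

Lemma set_R3_convex (R : realType) (gl gu bl bu : R) :
  gl < gu -> bl < 0 -> convex_set (M := 'rV[R]_5) (set_R3 gl gu bl bu).
Proof.
move=> hg hbl; apply/convex_setP => p q l.
rewrite [in X in X -> _](vec5_eta p) => /set_R3_cone-/(_ hg hbl) Rp.
rewrite [in X in X -> _](vec5_eta q) => /set_R3_cone-/(_ hg hbl) Rq l01.
rewrite (vec5_eta (_ + _)) !mxE; apply/set_R3_cone => //.
move: Rp Rq.
move: (p 0 0) (p 0 1) (p 0 2) (p 0 3) (p 0 4) => x1 u1 y1 z1 t1.
move: (q 0 0) (q 0 1) (q 0 2) (q 0 3) (q 0 4) => x2 u2 y2 z2 t2.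
move=> [[p1 p2 p3 p4] [p5 p6 p7 p8] [p9 p10 p11] p12].
move=> [[q1 q2 q3 q4] [q5 q6 q7 q8] [q9 q10 q11] q12].
have soc := rotated_cone_convex l01 p9 p10 p11 q9 q10 q11.
case/andP: l01 => l0 l1.
have mix (a b : R) : 0 <= a -> 0 <= b -> 0 <= l * a + (1 - l) * b.
  by move=> a0 b0; rewrite addr_ge0 ?mulr_ge0 ?subr_ge0.
have le_mix (a b c d : R) : a <= b -> c <= d ->
    l * a + (1 - l) * c <= l * b + (1 - l) * d.
  by move=> ab cd; rewrite lerD // ler_wpM2l // subr_ge0.
split.
- split; [have := le_mix _ _ _ _ p1 q1|have := le_mix _ _ _ _ p2 q2
    |have := le_mix _ _ _ _ p3 q3|have := le_mix _ _ _ _ p4 q4]; lra.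
- split; [have := le_mix _ _ _ _ p5 q5|have := le_mix _ _ _ _ p6 q6
    |have := le_mix _ _ _ _ p7 q7|have := le_mix _ _ _ _ p8 q8]; lra.
- split; [exact: mix|have := mix _ _ p10 q10; lra|].
  apply: le_trans soc _; lra.
- have := le_mix _ _ _ _ p12 q12; lra.
Qed.

(** * R3 is contained in every convex set containing T *)

Lemma apex_in_T (R : realType) (gl gu bl bu y z t : R) :
  bl < 0 -> 0 < bu -> y <= 0 -> z <= 1 -> bl * z <= y -> gl <= t <= gu ->
  set_T gl gu bl bu (vec5 0 0 y z t).
Proof.
move=> hbl hbu y0 z1 ybl ht.
have z0 : 0 <= z by rewrite -(nmulr_rle0 z hbl); lra.
have bz0 := mulr_ge0 (ltW hbu) z0.
by apply/set_T_vec5; split; [split|split| |] => //; lra.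
Qed.

(** The point over (x, t) at which y + u <= 0, z + x <= 1 and bl z <= y are all
    equalities. *)
Definition tight_point (R : nzRingType) (bl x t : R) : 'rV[R]_5 :=
  vec5 x (- bl * (1 - x)) (bl * (1 - x)) (1 - x) t.

(** The value x = - bl / (r - bl) is the one for which the coordinate
    u = - bl (1 - x) of the tight point equals x r. *)
Lemma tight_point_in_T (R : realType) (gl gu bl bu r : R) :
  0 < gl -> bl < 0 -> 0 < bu -> gl <= r <= gu ->
  set_T gl gu bl bu (tight_point bl (- bl / (r - bl)) r).
Proof.
move=> hgl hbl hbu /andP[glr rgu].
have rbl : r - bl > 0 by lra.
have x0 : 0 <= - bl / (r - bl) by rewrite divr_ge0; lra.
have x1 : - bl / (r - bl) <= 1 by rewrite ler_pdivrMr; lra.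
have xr : - bl / (r - bl) * (r - bl) = - bl by field; lra.
have := mulr_ge0 (ltW hbu) (_ : 0 <= 1 - - bl / (r - bl)).
rewrite subr_ge0 => /(_ x1) bu0.
apply/set_T_vec5; split; rewrite ?x0 ?glr //; split; nra.
Qed.

(** The upper bound on t is the height, over - bl / (r - bl), of the chord
    joining the tight points of T with t = gl and t = gu. *)
Lemma tight_point_in_hull (R : realType) (gl gu bl bu r t : R)
    (A : set 'rV[R]_5) :
  0 < gl -> gl < gu -> bl < 0 -> 0 < bu ->
  convex_set (M := 'rV[R]_5) A -> set_T gl gu bl bu `<=` A ->
  gl <= r <= gu ->
  r <= t -> t <= gu - (gl - bl) * (gu - r) / (r - bl) ->
  A (tight_point bl (- bl / (r - bl)) t).
Proof.
move=> hgl hg hbl hbu cA TA /andP[glr rgu] rt tc.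
have Tr s : gl <= s <= gu -> A (tight_point bl (- bl / (s - bl)) s).
  by move=> hs; apply: TA; apply: tight_point_in_T.
(* [m] is the weight of the end t = gl on the chord. *)
set m := (gl - bl) * (gu - r) / ((r - bl) * (gu - gl)).
have m01 : 0 <= m <= 1.
  by rewrite divr_ge0 ?ler_pdivrMr ?mulr_ge0 ?mulr_gt0 //; nra.
have chord : A (tight_point bl (- bl / (r - bl))
    (gu - (gl - bl) * (gu - r) / (r - bl))).
  apply: (convex_vec5 (l := m) cA
    (Tr gl _) (Tr gu _)) => //; rewrite ?lexx ?(ltW hg) //= /m; field;
    rewrite ?andbT; do ?[apply/and3P; split|apply/andP; split]; lra.
have [l l01 tE] := itv_interpolation rt tc.
have Cr : A (tight_point bl (- bl / (r - bl)) r) by apply: Tr; rewrite glr.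
by apply: (convex_vec5 (l := l) cA Cr chord); lra.
Qed.

(** For c > 0 divide by c. For c = 0 the triangle is reduced to the origin, so
    (y, z) = (0, 0) and any point of the unit triangle serves. *)
Lemma triangle_rescale (R : realFieldType) (bl c y z : R) :
  bl < 0 -> 0 <= c -> y <= 0 -> z <= c -> bl * z <= y ->
  exists y0 z0,
    [/\ y = c * y0, z = c * z0, y0 <= 0, z0 <= 1 & bl * z0 <= y0].
Proof.
move=> hbl c0 y0 zc ybl.
have z0 : 0 <= z by rewrite -(nmulr_rle0 z hbl); lra.
have [c_gt0|c_le0] := ltP 0 c; last first.
  have z00 : z = 0 by lra.
  by subst z; exists 0, 0; split; lra.
exists (y / c), (z / c); split; [by field; lra|by field; lra| | |].
- by rewrite ler_pdivrMr ?mul0r.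
- by rewrite ler_pdivrMr ?mul1r.
- by rewrite mulrA ler_pM2r ?invr_gt0.
Qed.

Lemma set_R3_sub_convex (R : realType) (gl gu bl bu : R) (A : set 'rV[R]_5) :
  0 < gl -> gl < gu -> bl < 0 -> 0 < bu ->
  convex_set (M := 'rV[R]_5) A -> set_T gl gu bl bu `<=` A ->
  set_R3 gl gu bl bu `<=` A.
Proof.
move=> hgl hg hbl hbu cA TA p.
rewrite (vec5_eta p) => /set_R3_cone-/(_ hg hbl).
move: (p 0 0) (p 0 1) (p 0 2) (p 0 3) (p 0 4) => x u y z t.
move=> [[yu zx ybu ybl] [glx gux mc1 mc2] [x0 _ soc] secant].
have [x_gt0|x_le0] := ltP 0 x; last first.
  have x00 : x = 0 by lra.
  subst x; have u0 : u = 0 by lra.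
  subst u; apply: TA; apply: apex_in_T; lra.
(* [lam] is the weight of the tight point, 1 - [lam] that of x = u = 0. *)
set r := u / x; set lam := x - u / bl.
have uE : u = r * x by rewrite /r; field; lra.
have glr : gl <= r by rewrite /r ler_pdivlMr; lra.
have rgu : r <= gu by rewrite /r ler_pdivrMr; lra.
have rbl : 0 < r - bl by lra.
have lamE : lam = x * (r - bl) / - bl by rewrite /lam uE; field; lra.
have lam_gt0 : 0 < lam by rewrite lamE divr_gt0 ?mulr_gt0 //; lra.
have ubl : u / bl * bl = u by field; lra.
(* This is u <= - bl z, from y + u <= 0 and bl z <= y. *)
have lamz : lam <= z + x.
  by rewrite /lam -subr_ge0 -(nmulr_rle0 _ hbl); lra.
(* Height of the chord over the tight point. *)
set up := gu - (gl - bl) * (gu - r) / (r - bl).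
have low_t : lam * r + (1 - lam) * gl <= t.
  have : lam * (r - gl) <= t - gl.
    rewrite lamE mulrAC ler_pdivrMr; last lra.
    rewrite -(ler_pM2l x_gt0); move: soc; rewrite uE; lra.
  lra.
have t_up : t <= lam * up + (1 - lam) * gu.
  have : lam * (gu - up) <= gu - t.
    have -> : lam * (gu - up) = (gl - bl) * (gu * x - u) / - bl.
      by rewrite lamE /up uE; field; apply/andP; split; lra.
    by rewrite ler_pdivrMr; lra.
  lra.
(* One weight [k] fixes the height of both end points at the same time. *)
have [k k01 tE] := itv_interpolation low_t t_up.
have r_up : r <= up.
  have -> : up = r + (gu - r) * (r - gl) / (r - bl) by rewrite /up; field; lra.
  by rewrite lerDl divr_ge0 ?mulr_ge0 //; lra.
have lam1 : lam <= 1 by lra.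
have lam1' : 0 <= 1 - lam by lra.
have zc : z + x - lam <= 1 - lam by lra.
have ylam : bl * (z + x - lam) <= y + u by rewrite /lam; lra.
have [y0 [z0 [yE zE y00 z01 yz0]]] := triangle_rescale hbl lam1' yu zc ylam.
have apex : A (vec5 0 0 y0 z0 (k * gl + (1 - k) * gu)).
  apply: TA; apply: apex_in_T => //.
  by case/andP: k01 => k0 k1; apply/andP; split; nra.
have tight : A (tight_point bl (- bl / (r - bl)) (k * r + (1 - k) * up)).
  apply: (tight_point_in_hull (gl := gl) (gu := gu) (bu := bu)) => //.
  - by rewrite glr.
  - case/andP: k01 => k0 k1; nra.
  - by rewrite -/up; case/andP: k01 => k0 k1; nra.
have lx : lam * (- bl / (r - bl)) = x.
  by rewrite lamE; field; apply/andP; split; lra.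
apply: (convex_vec5 (l := lam) cA tight apex).
- by rewrite lam1 ltW.
- by rewrite lx mulr0 addr0.
- rewrite mulr0 addr0 mulrCA mulrBr mulr1 lx /lam; lra.
- rewrite -yE mulrCA [lam * (1 - _)]mulrBr mulr1 lx /lam; lra.
- rewrite -zE mulrBr mulr1 lx /lam; lra.
- by rewrite tE; ring.
Qed.

Theorem theorem4p3 (R : realType) (gl gu bl bu : R)
    (hgl : 0 < gl) (hg : gl < gu) (hbl : bl < 0) (hbu : 0 < bu) :
  convex_hull (set_T gl gu bl bu) = set_R3 gl gu bl bu.
Proof.
apply/seteqP; split.
  by apply: smallest_sub; [exact: set_R3_convex|exact: set_T_sub_R3].
move=> p R3p A [cA TA]; exact: (set_R3_sub_convex hgl hg hbl hbu cA TA).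
Qed.
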